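(* The system $$u_t+uu_x+v_x=0,\qquad v_t+uv_x+u_x=0,\qquad w_t+uw_x=0$$ for unknown functions $u,v,w$ of $(t,x)$ possesses two independent (up to combining with each other and with continuous symmetries) discrete point symmetries given by the reflections $$(t,x,u,v,w)\to(-t,-x,u,v,w)\quad\text{and}\quad(t,x,u,v,w)\to(t,x,u,v,-w).$$
   Context: A point symmetry of the system is a (locally defined) transformation of the variables $(t,x,u,v,w)$, smooth with nonvanishing Jacobian, that maps the system to itself. Continuous symmetries are those in the identity component of the complete point symmetry group (the Lie symmetry group); discrete symmetries are point symmetries not in the identity component, considered up to composition with continuous symmetries and with each other. *)

(* Defs.v *)
From HB Require Import structures.
From mathcomp Require Import all_boot all_order all_algebra.
From mathcomp Require Import all_classical all_reals all_analysis.

Set Implicit Arguments.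
Unset Strict Implicit.
Unset Printing Implicit Defensive.

Import Order.TTheory GRing.Theory Num.Theory.
Import numFieldNormedType.Exports.

Local Open Scope classical_set_scope.
Local Open Scope ring_scope.

(* A point of the space of variables is a row vector (t, x | u, v, w): two
   independent variables followed by three dependent ones. *)
Definition space (R : realType) := 'rV[R]_(2 + 3).

Definition mkpoint (R : realType) (t x u v w : R) : space R :=
  row_mx (\row_(i < 2) [:: t; x]`_i) (\row_(a < 3) [:: u; v; w]`_a).

Definition tvar (R : realType) (z : space R) : R := @lsubmx R 1 2 3 z 0 0.
Definition xvar (R : realType) (z : space R) : R := @lsubmx R 1 2 3 z 0 1.
Definition uvar (R : realType) (z : space R) : R := @rsubmx R 1 2 3 z 0 0.
Definition vvar (R : realType) (z : space R) : R := @rsubmx R 1 2 3 z 0 1.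
Definition wvar (R : realType) (z : space R) : R := @rsubmx R 1 2 3 z 0 2.

(* Row i of p (0 for t, 1 for x) holds the derivatives of the unknown functions
   with respect to the i-th independent variable; column a is 0 for u, 1 for v,
   2 for w.  The pair (z, p) is a point of the first-order jet space. *)
Definition drift_flux_system (R : realType) (z : space R) (p : 'M[R]_(2, 3)) :
    Prop :=
  let u := uvar z in
  let u_t := p 0 0 in let v_t := p 0 1 in let w_t := p 0 2 in
  let u_x := p 1 0 in let v_x := p 1 1 in let w_x := p 1 2 in
  [/\ u_t + u * u_x + v_x = 0,
      v_t + u * v_x + u_x = 0 &
      w_t + u * w_x = 0].

(* The 2 x 5 matrix of total derivatives D_i Phi^j, i = t, x, at the jet (z, p).
   With the row-vector convention 'J Phi z k j is the derivative of Phi^j with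
   respect to the k-th variable, so that D_i Phi^j equals
   d_i Phi^j + \sum_a p i a * d_(u^a) Phi^j. *)
Definition total_derivative (R : realType) (Phi : space R -> space R)
    (z : space R) (p : 'M[R]_(2, 3)) : 'M[R]_(2, 2 + 3) :=
  row_mx 1%:M p *m 'J Phi z.

Definition base_derivative (R : realType) (Phi : space R -> space R)
    (z : space R) (p : 'M[R]_(2, 3)) : 'M[R]_2 :=
  lsubmx (total_derivative Phi z p).

Definition fibre_derivative (R : realType) (Phi : space R -> space R)
    (z : space R) (p : 'M[R]_(2, 3)) : 'M[R]_(2, 3) :=
  rsubmx (total_derivative Phi z p).

(* First prolongation: the chain rule says that the transformed derivatives q
   solve base_derivative Phi z p *m q = fibre_derivative Phi z p.  This is
   meaningful only where base_derivative Phi z p is invertible, i.e. where the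
   image of the graph of a function of (t, x) is again such a graph. *)
Definition prolong (R : realType) (Phi : space R -> space R)
    (z : space R) (p : 'M[R]_(2, 3)) : 'M[R]_(2, 3) :=
  invmx (base_derivative Phi z p) *m fibre_derivative Phi z p.

Definition iterated_partial (R : realType) (s : seq 'I_(2 + 3))
    (Phi : space R -> space R) : space R -> space R :=
  foldr (fun k (G : space R -> space R) => 'D_(delta_mx 0 k : space R) G) Phi s.

(* C^infinity on an open set U: all iterated partial derivatives exist and are
   differentiable (hence continuous) on U. *)
Definition smooth_on (R : realType) (U : set (space R))
    (Phi : space R -> space R) : Prop :=
  forall (s : seq 'I_(2 + 3)) (z : space R),
    U z -> differentiable (iterated_partial s Phi) z.

(* A local transformation is a pair of an open domain U and a function whose
   values outside U are irrelevant.  The system, as a submanifold of the jet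
   space, is mapped to itself by the prolonged transformation; the equivalence
   expresses this for the transformation and for its local inverse. *)
Definition point_symmetry (R : realType) (U : set (space R))
    (Phi : space R -> space R) : Prop :=
  [/\ open U,
      smooth_on U Phi,
      (forall z, U z -> \det ('J Phi z) != 0) &
      (forall z p, U z -> base_derivative Phi z p \in unitmx ->
         (drift_flux_system z p <->
          drift_flux_system (Phi z) (prolong Phi z p)))].

(* A path of point symmetries on U, from the identity to Phi, that is continuous
   for the topology of locally uniform convergence of all derivatives. *)
Definition isotopic_to_identity (R : realType) (U : set (space R))
    (Phi : space R -> space R) : Prop :=
  exists H : R -> space R -> space R,
    [/\ (forall s, `[0, 1]%classic s -> point_symmetry U (H s)),
        (forall a : seq 'I_(2 + 3),
           {within `[0, 1] `*` U,
             continuous (fun q : R * space R =>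
                           iterated_partial a (H q.1) q.2)}),
        (forall z, U z -> H 0 z = z) &
        (forall z, U z -> H 1 z = Phi z)].

(* Since symmetries are only locally defined, they form a pseudogroup, and
   "generated" means generated under composition, inversion, restriction to
   smaller open sets and gluing of local pieces.  Both restriction and gluing are
   instances of gen_loc, which also makes membership independent of the values
   of a transformation outside its domain. *)
Inductive generated (R : realType)
    (A : set (space R) -> (space R -> space R) -> Prop) :
    set (space R) -> (space R -> space R) -> Prop :=
| gen_base U Phi : A U Phi -> generated A U Phi
| gen_comp U V Phi Psi :
    generated A U Phi -> generated A V Psi -> Phi @` U `<=` V ->
    generated A U (Psi \o Phi)
| gen_inv U Phi Psi :
    generated A U Phi -> point_symmetry (Phi @` U) Psi ->
    (forall z, U z -> Psi (Phi z) = z) ->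
    generated A (Phi @` U) Psi
| gen_loc U Phi (V : space R -> set (space R))
    (F : space R -> space R -> space R) :
    open U ->
    (forall z, U z -> V z z) ->
    (forall z, U z -> generated A (V z) (F z)) ->
    (forall z y, U z -> U y -> V z y -> Phi y = F z y) ->
    generated A U Phi.

(* The identity component of the pseudogroup of point symmetries. *)
Definition continuous_symmetry (R : realType) :
    set (space R) -> (space R -> space R) -> Prop :=
  generated (@isotopic_to_identity R).

(* Discreteness is required of the germ at every point of the domain: no
   restriction to a smaller domain lies in the identity component. *)
Definition discrete_symmetry (R : realType) (U : set (space R))
    (Phi : space R -> space R) : Prop :=
  point_symmetry U Phi /\
  forall V : set (space R), open V -> V !=set0 -> V `<=` U ->
    ~ continuous_symmetry V Phi.

(* The symmetries obtained by combining Phi, the symmetries in the identity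
   component, and their inverses. *)
Definition generated_with (R : realType) (Phi : space R -> space R) :
    set (space R) -> (space R -> space R) -> Prop :=
  generated (fun U Psi =>
    isotopic_to_identity U Psi \/ point_symmetry U Psi /\ Psi = Phi).

(* Neither of two global transformations is a combination of the other one with
   continuous symmetries, on any domain whatsoever. *)
Definition independent_symmetries (R : realType)
    (Phi Psi : space R -> space R) : Prop :=
  forall V : set (space R), open V -> V !=set0 ->
    ~ generated_with Psi V Phi /\ ~ generated_with Phi V Psi.

Definition reflection_tx (R : realType) (z : space R) : space R :=
  mkpoint (- tvar z) (- xvar z) (uvar z) (vvar z) (wvar z).

Definition reflection_w (R : realType) (z : space R) : space R :=
  mkpoint (tvar z) (xvar z) (uvar z) (vvar z) (- wvar z).

(* Main.v *)
Require Import Defs.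
From HB Require Import structures.
From mathcomp Require Import all_boot all_order all_algebra.
From mathcomp Require Import ring lra.
From mathcomp Require Import all_classical all_reals all_analysis.

(* In the Riemann invariants u + v, u - v, w the system is diagonal, and its
   solutions are the surfaces on which the three decomposable 2-forms
   d(u + v) /\ (dx - (u + 1) dt), d(u - v) /\ (dx - (u - 1) dt), dw /\ (dx - u dt)
   vanish.  The differential of a point symmetry maps tangent planes of solutions
   to tangent planes of solutions; if it is moreover close enough to the identity,
   it preserves each of the three forms up to a factor.  Pure linear algebra then
   shows that the new t depends on t alone, that the new t and x depend only on t
   and x, and that the derivatives of the new w along u and v vanish.  This
   closed condition on an invertible Jacobian implies the open condition from
   which it was derived, so along an isotopy of symmetries starting at the
   identity both hold throughout, and the derivatives of the new t along t and of
   the new w along w stay positive.  The positivity of either derivative (the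
   second one together with the invariance of the (t, x)-directions) is stable
   under composition, inversion and localization, but the first is violated by
   (t, x) -> (-t, -x) and the second by w -> -w, while each of the two reflections
   satisfies the positivity violated by the other. *)

Set Implicit Arguments.
Unset Strict Implicit.
Unset Printing Implicit Defensive.

Import Order.TTheory GRing.Theory Num.Theory.
Import numFieldNormedType.Exports.

Local Open Scope classical_set_scope.
Local Open Scope ring_scope.

(* mathcomp's vector.v also exports a notation named space. *)
Local Notation space := Defs.space.

(** * Coordinates, Riemann invariants and the adapted frame *)

Section Coordinates.
Variable R : realType.
Implicit Types (y z : space R) (u : R).

Fact tvar_is_linear : linear (@tvar R : space R -> R^o).
Proof. by move=> a y z; rewrite /tvar !mxE. Qed.
Fact xvar_is_linear : linear (@xvar R : space R -> R^o).
Proof. by move=> a y z; rewrite /xvar !mxE. Qed.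
Fact uvar_is_linear : linear (@uvar R : space R -> R^o).
Proof. by move=> a y z; rewrite /uvar !mxE. Qed.
Fact vvar_is_linear : linear (@vvar R : space R -> R^o).
Proof. by move=> a y z; rewrite /vvar !mxE. Qed.
Fact wvar_is_linear : linear (@wvar R : space R -> R^o).
Proof. by move=> a y z; rewrite /wvar !mxE. Qed.

HB.instance Definition _ := GRing.isLinear.Build R (space R) R^o _ (@tvar R) tvar_is_linear.
HB.instance Definition _ := GRing.isLinear.Build R (space R) R^o _ (@xvar R) xvar_is_linear.
HB.instance Definition _ := GRing.isLinear.Build R (space R) R^o _ (@uvar R) uvar_is_linear.
HB.instance Definition _ := GRing.isLinear.Build R (space R) R^o _ (@vvar R) vvar_is_linear.
HB.instance Definition _ := GRing.isLinear.Build R (space R) R^o _ (@wvar R) wvar_is_linear.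

Lemma ord2_ind (P : 'I_2 -> Prop) : P 0 -> P 1 -> forall i, P i.
Proof.
move=> P0 P1 [[|[|//]] Hi].
- by rewrite (_ : Ordinal Hi = 0) //; apply: val_inj.
- by rewrite (_ : Ordinal Hi = 1) //; apply: val_inj.
Qed.

Lemma ord3_ind (P : 'I_3 -> Prop) : P 0 -> P 1 -> P 2 -> forall i, P i.
Proof.
move=> P0 P1 P2 [[|[|[|//]]] Hi].
- by rewrite (_ : Ordinal Hi = 0) //; apply: val_inj.
- by rewrite (_ : Ordinal Hi = 1) //; apply: val_inj.
- by rewrite (_ : Ordinal Hi = 2) //; apply: val_inj.
Qed.

Lemma tvar_mkpoint (t x u v w : R) : tvar (mkpoint t x u v w) = t.
Proof. by rewrite /tvar /mkpoint row_mxKl mxE. Qed.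
Lemma xvar_mkpoint (t x u v w : R) : xvar (mkpoint t x u v w) = x.
Proof. by rewrite /xvar /mkpoint row_mxKl mxE. Qed.
Lemma uvar_mkpoint (t x u v w : R) : uvar (mkpoint t x u v w) = u.
Proof. by rewrite /uvar /mkpoint row_mxKr mxE. Qed.
Lemma vvar_mkpoint (t x u v w : R) : vvar (mkpoint t x u v w) = v.
Proof. by rewrite /vvar /mkpoint row_mxKr mxE. Qed.
Lemma wvar_mkpoint (t x u v w : R) : wvar (mkpoint t x u v w) = w.
Proof. by rewrite /wvar /mkpoint row_mxKr mxE. Qed.

Definition mkpointE :=
  (tvar_mkpoint, xvar_mkpoint, uvar_mkpoint, vvar_mkpoint, wvar_mkpoint).

Lemma space_ext y z : tvar y = tvar z -> xvar y = xvar z ->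
  uvar y = uvar z -> vvar y = vvar z -> wvar y = wvar z -> y = z.
Proof.
move=> et ex eu ev ew; rewrite -[y]hsubmxK -[z]hsubmxK; congr row_mx.
- by apply/rowP; apply: ord2_ind.
- by apply/rowP; apply: ord3_ind.
Qed.

Lemma lsubmx_eq0 y : lsubmx y = 0 <-> tvar y = 0 /\ xvar y = 0.
Proof.
split=> [y0|[t0 x0]]; first by rewrite /tvar /xvar y0 !mxE.
by apply/rowP; apply: ord2_ind; rewrite [RHS]mxE.
Qed.

(* Speeds of the Riemann invariants u + v, u - v, w relative to u. *)
Definition speed (i : 'I_3) : R := [:: 1; -1; 0]`_i.

Definition riemann (i : 'I_3) y : R :=
  [:: uvar y + vvar y; uvar y - vvar y; wvar y]`_i.

Definition contact u (i : 'I_3) y : R := xvar y - (u + speed i) * tvar y.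

(* The i-th of the 2-forms whose vanishing on surfaces is the system. *)
Definition wedge u (i : 'I_3) y z : R :=
  riemann i y * contact u i z - contact u i y * riemann i z.

Definition area y z : R := tvar y * xvar z - xvar y * tvar z.

(* A frame of the tangent space at a point whose u-coordinate is u: d_t + u d_x,
   d_x, and the directions of the three Riemann invariants. *)
Definition vecT u : space R := mkpoint 1 u 0 0 0.
Definition vecX : space R := mkpoint 0 1 0 0 0.
Definition vecY (i : 'I_3) : space R :=
  nth 0 [:: mkpoint 0 0 1 1 0; mkpoint 0 0 1 (-1) 0; mkpoint 0 0 0 0 1] i.

Fact riemann_is_linear i : linear (riemann i : space R -> R^o).
Proof.
move=> a y z; move: i; apply: ord3_ind; rewrite /riemann /= !linearP //=.
- by rewrite /GRing.scale /=; ring.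
- by rewrite /GRing.scale /=; ring.
Qed.
HB.instance Definition _ i :=
  GRing.isLinear.Build R (space R) R^o _ (riemann i) (riemann_is_linear i).

Fact contact_is_linear u i : linear (contact u i : space R -> R^o).
Proof.
move=> a y z; rewrite /contact !linearP //= /GRing.scale /=; ring.
Qed.
HB.instance Definition _ u i :=
  GRing.isLinear.Build R (space R) R^o _ (contact u i) (contact_is_linear u i).

Lemma speed_inj : injective speed.
Proof.
apply: ord3_ind; apply: ord3_ind; rewrite /speed /= => H;
  first [reflexivity | exfalso; lra].
Qed.

Lemma riemann_vecY i j : riemann i (vecY j) = riemann i (vecY i) *+ (i == j).
Proof.
move: i j; apply: ord3_ind; apply: ord3_ind;
  rewrite /riemann /vecY /= !mkpointE /= ?mulr1n ?mulr0n
  ?addr0 ?subr0 ?subrr //.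
Qed.

Lemma riemann_vecY_neq0 i : riemann i (vecY i) != 0.
Proof.
move: i; apply: ord3_ind; rewrite /riemann /vecY /= !mkpointE /= ?opprK ?oner_eq0
  // -mulr2n pnatr_eq0.
Qed.

Lemma tvar_vecY i : tvar (vecY i) = 0.
Proof. by move: i; apply: ord3_ind; rewrite /vecY /= mkpointE. Qed.
Lemma xvar_vecY i : xvar (vecY i) = 0.
Proof. by move: i; apply: ord3_ind; rewrite /vecY /= mkpointE. Qed.

Lemma space_decomp u y : y = tvar y *: vecT u + (xvar y - u * tvar y) *: vecX
  + \sum_(i < 3) (riemann i y / riemann i (vecY i)) *: vecY i.
Proof.
rewrite !big_ord_recl big_ord0 addr0 /=.
rewrite (_ : lift _ (lift _ _) = 2 :> 'I_3); last exact: val_inj.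
rewrite (_ : lift _ _ = 1 :> 'I_3); last exact: val_inj.
by apply: space_ext; rewrite !linearD !linearZ /riemann /vecY /= !mkpointE
  /GRing.scale /=; field.
Qed.

End Coordinates.

Lemma big_ord3 (V : nmodType) (F : 'I_3 -> V) : \sum_i F i = F 0 + F 1 + F 2.
Proof.
rewrite !big_ord_recl big_ord0 addr0 addrA.
by congr (F _ + F _ + F _); apply: val_inj.
Qed.

(** * Action of a symmetry on tangent planes of solutions *)

Section Algebra.
Variable R : realType.
Implicit Types (y z : space R) (u : R) (A : 'M[R]_(2 + 3)).

(** Evaluation at points with coordinates 0, 1 and -1 suffices: the polynomial with coefficients
    [d0] to [d3] has mean [d0] over (1, 0) and (-1, 0), and likewise over the other symmetric sets
    of such points. *)
Lemma multiaffine_vanish (d0 d1 d2 d3 p0 p1 p2 p3 : R) : d0 != 0 ->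
    (forall a b, d0 + d1 * a + d2 * b + d3 * (a * b) != 0 ->
                 p0 + p1 * a + p2 * b + p3 * (a * b) = 0) ->
  [/\ p0 = 0, p1 = 0, p2 = 0 & p3 = 0].
Proof.
move=> d0N0 H.
have p00 : p0 = 0.
  by have := H 0 0; rewrite !mulr0 !addr0; apply.
have p10 : p1 = 0.
  have [e|e] := eqVneq (d0 + d1) 0.
    have := H (-1) 0; rewrite !mulr0 !addr0 p00 add0r !mulrN1 => /(_ _)/eqP.
    rewrite oppr_eq0 => /(_ _)/eqP; apply; apply: contra_neq d0N0 => e'; lra.
  by have := H 1 0; rewrite !mulr0 !addr0 p00 add0r !mulr1; exact.
have p20 : p2 = 0.
  have [e|e] := eqVneq (d0 + d2) 0.
    have := H 0 (-1); rewrite !(mul0r, mulr0) !addr0 p00 !add0r !mulrN1.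
    move=> /(_ _)/eqP.
    rewrite oppr_eq0 => /(_ _)/eqP; apply; apply: contra_neq d0N0 => e'; lra.
  by have := H 0 1; rewrite !(mul0r, mulr0) !addr0 p00 !add0r !mulr1; exact.
split=> //; apply/eqP; apply: contraNT d0N0 => p3N0; apply/eqP.
(* If [p3] were nonzero, this polynomial would vanish at the four points with both coordinates 1 or
   -1, where its values sum to 4 [d0]. *)
have K a b : a * b != 0 -> d0 + d1 * a + d2 * b + d3 * (a * b) = 0.
  move=> abN0; apply/eqP; apply: contraNT p3N0 => /H.
  by rewrite p00 p10 p20 !mul0r !add0r => /eqP; rewrite mulf_eq0 (negbTE abN0) orbF.
have n1 : (1 : R) != 0 by exact: oner_neq0.
have := K 1 1; have := K 1 (-1); have := K (-1) 1; have := K (-1) (-1).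
rewrite !(mulrN1, mulr1, opprK) oppr_eq0 => /(_ n1) ? /(_ n1) ? /(_ n1) ? /(_ n1) ?.
lra.
Qed.

(* The tangent planes of solutions are spanned by these two vectors, where a
   consists of the x-derivatives of the Riemann invariants in the basis vecY. *)
Definition jet_plane_T u (a : 'I_3 -> R) : space R :=
  vecT u - \sum_i (speed R i * a i) *: vecY R i.

Definition jet_plane_X (a : 'I_3 -> R) : space R :=
  vecX R + \sum_i a i *: vecY R i.

(* u and u' are the u-coordinates of the source and of the target point. *)
Definition symmetry_at u u' A :=
  forall (a : 'I_3 -> R) i,
    area (jet_plane_T u a *m A) (jet_plane_X a *m A) != 0 ->
    wedge u' i (jet_plane_T u a *m A) (jet_plane_X a *m A) = 0.

(** On a plane of slope [q] the system makes the differential of each Riemann invariant equal to its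
    [contact] form times its x-derivative, so the two factors of the 2-form are proportional. *)
Lemma solution_wedge z (q : 'M[R]_(2, 3)) i y1 y2 :
  drift_flux_system z q -> rsubmx y1 = lsubmx y1 *m q ->
  rsubmx y2 = lsubmx y2 *m q -> wedge (uvar z) i y1 y2 = 0.
Proof.
case; set u := uvar z => e1 e2 e3.
have {}e1 : q 0 0 = - (u * q 1 0) - q 1 1 by lra.
have {}e2 : q 0 1 = - (u * q 1 1) - q 1 0 by lra.
have {}e3 : q 0 2 = - (u * q 1 2) by lra.
have E y : rsubmx y = lsubmx y *m q ->
    riemann i y = contact u i y * [:: q 1 0 + q 1 1; q 1 0 - q 1 1; q 1 2]`_i.
  move=> h; have h' a : rsubmx y 0 a = tvar y * q 0 a + xvar y * q 1 a.
    rewrite h mxE !big_ord_recl big_ord0 addr0.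
    by rewrite (_ : lift _ _ = 1 :> 'I_2) //; apply: val_inj.
  move: i; apply: ord3_ind; rewrite /riemann /contact /speed /uvar /vvar /wvar
    !h' /= ?e1 ?e2 ?e3; ring.
by move=> /E h1 /E h2; rewrite /wedge h1 h2; ring.
Qed.

Lemma jet_plane_solution z (a : 'I_3 -> R) :
  exists2 p : 'M[R]_(2, 3), drift_flux_system z p &
    jet_plane_X a = row 1 (row_mx 1%:M p) /\
    jet_plane_T (uvar z) a = row 0 (row_mx 1%:M p) + uvar z *: row 1 (row_mx 1%:M p).
Proof.
set u := uvar z.
pose px (i : 'I_3) := [:: a 0 + a 1; a 0 - a 1; a 2]`_i.
(* Derivatives along d_t + u d_x as dictated by the system: - v_x, - u_x and 0. *)
pose pt (i : 'I_3) := [:: - a 0 + a 1; - a 0 - a 1; 0]`_i.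
pose p : 'M[R]_(2, 3) := \matrix_(k, i) if k == 0 then pt i - u * px i else px i.
have X : jet_plane_X a = row 1 (row_mx 1%:M p).
  rewrite row_row_mx /jet_plane_X big_ord3.
  by apply: space_ext; rewrite ?linearD ?linearZ /vecY /vecX /= !mkpointE
    /tvar /xvar /uvar /vvar /wvar ?row_mxKl ?row_mxKr !mxE /= /GRing.scale /px /=;
    ring.
exists p => //; last split=> //.
  by rewrite /drift_flux_system !mxE /= /pt /px /= -/u; split; ring.
rewrite !row_row_mx /jet_plane_T big_ord3 /speed.
by apply: space_ext; rewrite ?linearB ?linearD ?linearZ /vecY /vecT /= !mkpointE
    /tvar /xvar /uvar /vvar /wvar ?row_mxKl ?row_mxKr !mxE /= /GRing.scale
    /px /pt /=; ring.
Qed.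

Lemma area_det (M : 'M[R]_(2, 2 + 3)) :
  area (row 0 M) (row 1 M) = \det (lsubmx M).
Proof.
rewrite (expand_det_row _ 0) !big_ord_recl big_ord0 addr0.
rewrite /cofactor !det_mx11 !mxE /= /area /tvar /xvar !mxE /=; rewrite expr0 expr1.
rewrite (_ : lift (lift _ _) _ = 0 :> 'I_2); last exact: val_inj.
rewrite (_ : lift _ _ = 1 :> 'I_2); last exact: val_inj.
ring.
Qed.

Lemma areaD u y z : area (y + u *: z) z = area y z.
Proof. by rewrite /area !linearD !linearZ /= /GRing.scale /=; ring. Qed.

Lemma wedgeD u u' i y z : wedge u' i (y + u *: z) z = wedge u' i y z.
Proof. by rewrite /wedge !linearD !linearZ /= /GRing.scale /=; ring. Qed.

(** The rows of [total_derivative Phi z p] span the image plane. Their [area] is the determinant of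
    the base derivative; where it is nonzero, the plane has slope [prolong Phi z p], which solves
    the system at [Phi z]. *)
Lemma point_symmetry_at U Phi z : point_symmetry U Phi -> U z ->
  symmetry_at (uvar z) (uvar (Phi z)) ('J Phi z).
Proof.
move=> [_ _ _ S] Uz a i; have [p zp [-> ->]] := jet_plane_solution z a.
set M := total_derivative Phi z p.
have MT : row 0 (row_mx 1%:M p) *m 'J Phi z = row 0 M by rewrite -row_mul.
have MX : row 1 (row_mx 1%:M p) *m 'J Phi z = row 1 M by rewrite -row_mul.
rewrite mulmxDl -scalemxAl MT MX areaD wedgeD area_det => detN0.
have unitM : base_derivative Phi z p \in unitmx by rewrite unitmxE unitfE.
have qE k : rsubmx (row k M) = lsubmx (row k M) *m prolong Phi z p.
  have -> : rsubmx (row k M) = row k (rsubmx M) by apply/rowP=> j; rewrite !mxE.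
  have -> : lsubmx (row k M) = row k (lsubmx M) by apply/rowP=> j; rewrite !mxE.
  by rewrite -row_mul /prolong mulKVmx.
by apply: (solution_wedge (q := prolong Phi z p)) => //; apply/(S z p Uz unitM).
Qed.

Lemma wedgeC u i y z : wedge u i z y = - wedge u i y z.
Proof. rewrite /wedge; ring. Qed.

(** The form is alternating, so the terms in the squares of [a] and [b] cancel. *)
Lemma jet_plane_expand (f g : {linear space R -> R^o}) (T X Yj Yk : space R) (lj lk a b : R) :
  let w y z := f y * g z - g y * f z in
  w (T - ((lj * a) *: Yj + (lk * b) *: Yk)) (X + (a *: Yj + b *: Yk)) =
  w T X + (w T Yj - lj * w Yj X) * a + (w T Yk - lk * w Yk X) * b +
  ((lk - lj) * w Yj Yk) * (a * b).
Proof.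
move=> w; rewrite /w !linearB !linearD !linearZ /= /GRing.scale /=; ring.
Qed.

(** Jets with at most two nonzero components turn the hypothesis into an instance of
    [multiaffine_vanish]; the factor [lk - lj] of the mixed term is nonzero because the speeds are
    distinct. *)
Lemma symmetry_at_forms u u' A :
    symmetry_at u u' A -> area (vecT u *m A) (vecX R *m A) != 0 ->
  [/\ forall i, wedge u' i (vecT u *m A) (vecX R *m A) = 0,
      forall i j, wedge u' i (vecT u *m A) (vecY R j *m A) =
                  speed R j * wedge u' i (vecY R j *m A) (vecX R *m A) &
      forall i j k, wedge u' i (vecY R j *m A) (vecY R k *m A) = 0].
Proof.
move=> S D0.
have K i j k : j != k ->
  [/\ wedge u' i (vecT u *m A) (vecX R *m A) = 0,
      wedge u' i (vecT u *m A) (vecY R j *m A) =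
                  speed R j * wedge u' i (vecY R j *m A) (vecX R *m A) &
      wedge u' i (vecY R j *m A) (vecY R k *m A) = 0].
  move=> jk.
  pose c a b (l : 'I_3) : R := if l == j then a else if l == k then b else 0.
  have sumc (F : 'I_3 -> R) a b :
      \sum_l (F l * c a b l) *: vecY R l = (F j * a) *: vecY R j + (F k * b) *: vecY R k.
    rewrite (bigD1 j) //= (bigD1 k) 1?eq_sym //= big1 ?addr0.
      by rewrite /c eqxx eq_sym (negbTE jk) eqxx.
    by move=> l /andP[lj lk]; rewrite /c (negbTE lj) (negbTE lk) mulr0 scale0r.
  have sumc1 a b : \sum_l c a b l *: vecY R l = a *: vecY R j + b *: vecY R k.
    by have := sumc (fun=> 1) a b; under eq_bigr do rewrite mul1r; rewrite !mul1r.
  have := fun a b => S (c a b) i; rewrite /jet_plane_T /jet_plane_X.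
  set VT := vecT u *m A in D0 *; set VX := vecX R *m A in D0 *.
  set Yj := vecY R j *m A; set Yk := vecY R k *m A.
  set lj := speed R j; set lk := speed R k => H.
  have := @multiaffine_vanish (area VT VX)
    (area VT Yj - lj * area Yj VX) (area VT Yk - lk * area Yk VX)
    ((lk - lj) * area Yj Yk)
    (wedge u' i VT VX) (wedge u' i VT Yj - lj * wedge u' i Yj VX)
    (wedge u' i VT Yk - lk * wedge u' i Yk VX)
    ((lk - lj) * wedge u' i Yj Yk) D0.
  case.
    move=> a b; have := H a b; rewrite sumc sumc1.
    rewrite mulmxBl !mulmxDl -!scalemxAl -/VT -/VX -/Yj -/Yk -/lj -/lk.
    have /= := jet_plane_expand (riemann i) (contact u' i) VT VX Yj Yk lj lk a b.
    have /= := jet_plane_expand (@tvar R) (@xvar R) VT VX Yj Yk lj lk a b.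
    by rewrite -/(area _ _) -/(wedge u' i _ _) => -> ->.
  move=> -> /eqP; rewrite subr_eq0 => /eqP -> _ /eqP; rewrite mulf_eq0 subr_eq0.
  by rewrite (inj_eq (@speed_inj R)) eq_sym (negbTE jk) => /eqP ->.
split=> [i|i j|i j k].
- by have [] := K i 0 1 isT.
- have [->|jN0] := eqVneq j 0; first by have [] := K i 0 1 isT.
  by have [] := K i j 0 jN0.
- have [->|jk] := eqVneq j k; last by have [] := K i j k jk.
  by rewrite /wedge mulrC subrr.
Qed.

End Algebra.

(** * Shape of the Jacobian of a symmetry *)

Section Structure.
Variable R : realType.
Implicit Types (y z : space R) (u : R) (A : 'M[R]_(2 + 3)).

(* An open condition on A which, for symmetries, is equivalent to the closed
   condition triangular. *)
Definition noncharacteristic u u' A :=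
  area (vecT u *m A) (vecX R *m A) != 0 /\
  forall i, wedge u' i (vecY R i *m A) (vecX R *m A) != 0.

Definition triangular A :=
  [/\ tvar (vecX R *m A) = 0,
      forall k, tvar (vecY R k *m A) = 0,
      forall k, xvar (vecY R k *m A) = 0 &
      forall i k, i != k -> riemann i (vecY R k *m A) = 0].

(** The vector (p, q) is parallel to two independent vectors of the plane; Cramer's rule shows that
    it is zero. *)
Lemma wedge_kernel (p q p0 q0 px qx : R) : p0 * qx - q0 * px != 0 ->
  p * q0 - q * p0 = 0 -> p * qx - q * px = 0 -> p = 0 /\ q = 0.
Proof.
move=> N0 e0 ex; split; apply/eqP; rewrite -(mulIr_eq0 _ (mulIf N0)); apply/eqP.
- have -> : p * (p0 * qx - q0 * px) =
     p0 * (p * qx - q * px) - px * (p * q0 - q * p0) by ring.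
  by rewrite e0 ex !mulr0 subr0.
- have -> : q * (p0 * qx - q0 * px) =
     q0 * (p * qx - q * px) - qx * (p * q0 - q * p0) by ring.
  by rewrite e0 ex !mulr0 subr0.
Qed.

(** The Pluecker relation: a decomposable 2-form has zero exterior square. *)
Lemma plucker (f g : space R -> R) y1 y2 y3 y4 :
  let w y z := f y * g z - g y * f z in
  w y1 y2 * w y3 y4 - w y1 y3 * w y2 y4 + w y1 y4 * w y2 y3 = 0.
Proof. move=> w; rewrite /w; ring. Qed.

(** By [plucker] and the distinctness of the speeds, the image of [vecY R j] pairs to zero with
    those of [vecY R i] and [vecX R], on which the i-th form is nondegenerate; hence both factors of
    the form vanish on it. The image of the characteristic direction [vecT u + speed R i *: vecX R]
    also pairs to zero with these two. *)
Lemma symmetry_at_kernel u u' A : symmetry_at u u' A ->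
  noncharacteristic u u' A -> forall i,
  [/\ forall j, j != i -> riemann i (vecY R j *m A) = 0 /\ contact u' i (vecY R j *m A) = 0 &
      contact u' i (vecT u *m A) + speed R i * contact u' i (vecX R *m A) = 0].
Proof.
move=> S [D0 N0] i; have [e1 e2 e3] := symmetry_at_forms S D0.
have {}N0 := N0 i; have {}e1 := e1 i; have {}e2 := e2 i; have {}e3 := e3 i.
have yx j : j != i -> wedge u' i (vecY R j *m A) (vecX R *m A) = 0.
  move=> ji; have := plucker (riemann i) (contact u' i) (vecY R i *m A)
    (vecY R j *m A) (vecX R *m A) (vecT u *m A).
  rewrite /= -!/(wedge u' i _ _) e3 mul0r sub0r.
  rewrite (wedgeC u' i (vecT u *m A) (vecY R j *m A)).
  rewrite (wedgeC u' i (vecT u *m A) (vecY R i *m A)) !e2.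
  set a := wedge _ _ _ _ in N0 *; set b := wedge _ _ _ _.
  have -> : - (a * - (speed R j * b)) + - (speed R i * a) * b =
    (speed R j - speed R i) * a * b by ring.
  move/eqP; rewrite !mulf_eq0 subr_eq0 (inj_eq (@speed_inj R)) (negbTE ji).
  by rewrite (negbTE N0) => /eqP.
split=> [j ji|].
  by apply: wedge_kernel N0 _ _; [exact: e3|exact: yx].
suff [] : riemann i (vecT u *m A) + speed R i * riemann i (vecX R *m A) = 0 /\
    contact u' i (vecT u *m A) + speed R i * contact u' i (vecX R *m A) = 0 by [].
apply: wedge_kernel N0 _ _.
- by have := e2 i; rewrite /wedge; lra.
- by move: e1; rewrite /wedge; lra.
Qed.

(** The image of [vecY R k] is annihilated by the [contact] forms of the two other indices, which
    are independent combinations of dt and dx. *)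
Lemma symmetry_at_triangular u u' A : symmetry_at u u' A ->
  noncharacteristic u u' A -> triangular A.
Proof.
move=> S /(symmetry_at_kernel S) K.
have cY i k : i != k -> contact u' i (vecY R k *m A) = 0.
  by rewrite eq_sym => ki; have [/(_ _ ki)[]] := K i.
have tx k : tvar (vecY R k *m A) = 0 /\ xvar (vecY R k *m A) = 0.
  have [i [j [ij ik jk]]] : exists i j : 'I_3, [/\ i != j, i != k & j != k].
    by move: k; apply: ord3_ind; [exists 1, 2|exists 0, 2|exists 0, 1].
  have := cY i k ik; have := cY j k jk; rewrite /contact => ej ei.
  have t0 : tvar (vecY R k *m A) = 0.
    apply/eqP; have : (speed R i - speed R j) * tvar (vecY R k *m A) == 0.
      by apply/eqP; move: ei ej; lra.
    by rewrite mulf_eq0 subr_eq0 (inj_eq (@speed_inj R)) (negbTE ij).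
  by move: ei; rewrite t0 mulr0 subr0.
have [_ E0] := K 0; have [_ E1] := K 1; have [_ E2] := K 2.
split=> [|k|k|i k ik]; last 3 first.
- by case: (tx k).
- by case: (tx k).
- by rewrite eq_sym in ik; have [/(_ _ ik)[]] := K i.
(* A quadratic polynomial in the speed vanishes at 1, -1 and 0; its leading coefficient is minus the
   [tvar] of the image of [vecX R]. *)
move: E0 E1 E2; rewrite /contact /speed /=; nra.
Qed.

Lemma triangular_image u A y : triangular A ->
  [/\ tvar (y *m A) = tvar y * tvar (vecT u *m A),
      tvar y = 0 -> xvar (y *m A) = xvar y * xvar (vecX R *m A) &
      tvar y = 0 -> xvar y = 0 -> forall i,
        riemann i (y *m A) =
        riemann i y / riemann i (vecY R i) * riemann i (vecY R i *m A)].
Proof.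
move=> [tX tY xY rY].
have E (f : {linear space R -> R^o}) : f (y *m A) = tvar y * f (vecT u *m A)
    + (xvar y - u * tvar y) * f (vecX R *m A)
    + \sum_i riemann i y / riemann i (vecY R i) * f (vecY R i *m A).
  rewrite {1}(space_decomp u y) !mulmxDl -!scalemxAl mulmx_suml.
  rewrite 2!linearD !linearZ linear_sum; congr (_ + _); apply: eq_bigr => i _.
  by rewrite -scalemxAl linearZ.
split=> [|t0|t0 x0 i]; rewrite E /=.
- by rewrite tX mulr0 addr0 big1 ?addr0 // => k _; rewrite tY mulr0.
- rewrite t0 mul0r add0r mulr0 subr0 big1 ?addr0 // => k _.
  by rewrite xY mulr0.
- rewrite t0 x0 mulr0 subr0 !mul0r !add0r (bigD1 i) //= big1 ?addr0 // => k ki.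
  by rewrite rY 1?eq_sym // mulr0.
Qed.

(** These are the diagonal entries; each is nonzero because the corresponding frame vector has a
    preimage. *)
Lemma triangular_unit u A : triangular A -> A \in unitmx ->
  [/\ tvar (vecT u *m A) != 0, xvar (vecX R *m A) != 0 &
      forall i, riemann i (vecY R i *m A) != 0].
Proof.
move=> trA uA.
have surj z : exists y, y *m A = z by exists (z *m invmx A); rewrite mulmxKV.
have tT : tvar (vecT u *m A) != 0.
  have [y yT] := surj (vecT u); have [+ _ _] := triangular_image u y trA.
  rewrite yT [LHS]mkpointE => e.
  by apply/eqP => t0; move/eqP: e; rewrite t0 mulr0 oner_eq0.
have t0 y : tvar (y *m A) = 0 -> tvar y = 0.
  have [-> _ _] := triangular_image u y trA.
  by move/eqP; rewrite mulf_eq0 (negbTE tT) orbF => /eqP.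
have xX : xvar (vecX R *m A) != 0.
  have [y yX] := surj (vecX R); have [_ + _] := triangular_image u y trA.
  rewrite t0 ?yX ?mkpointE // => /(_ erefl) e.
  by apply/eqP => x0; move/eqP: e; rewrite x0 mulr0 oner_eq0.
split=> // i; have [y yY] := surj (vecY R i).
have ty : tvar y = 0 by rewrite t0 // yY tvar_vecY.
have xy : xvar y = 0.
  have [_ /(_ ty) + _] := triangular_image u y trA.
  rewrite yY xvar_vecY => /esym/eqP.
  by rewrite mulf_eq0 (negbTE xX) orbF => /eqP.
have [_ _ /(_ ty xy i)] := triangular_image u y trA.
rewrite yY => e; apply/eqP => r0; move/eqP: e.
by rewrite r0 mulr0 (negbTE (riemann_vecY_neq0 R i)).
Qed.

(** The area and the wedges become products of diagonal entries, so the closed condition implies the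
    open one. *)
Lemma triangular_noncharacteristic u u' A :
  triangular A -> A \in unitmx -> noncharacteristic u u' A.
Proof.
move=> trA uA; have [tT xX rY] := triangular_unit u trA uA.
case: trA => tX tY xY _; split=> [|i].
  by rewrite /area tX mulr0 subr0 mulf_neq0.
rewrite /wedge /contact tX tY xY !mulr0 !subr0 mul0r subr0.
exact: mulf_neq0.
Qed.

(** * Orientation conditions stable under products and inverses *)

Definition time_oriented A := forall y, Num.sg (tvar (y *m A)) = Num.sg (tvar y).

(** The first clause makes the vertical directions, dt = dx = 0, invariant both ways, which lets the
    sign condition on them compose and invert. *)
Definition w_oriented A :=
  (forall y, (lsubmx (y *m A) == 0) = (lsubmx y == 0)) /\
  (forall y, lsubmx y = 0 -> Num.sg (wvar (y *m A)) = Num.sg (wvar y)).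

Lemma triangular_time_oriented u A : triangular A ->
  0 < tvar (vecT u *m A) -> time_oriented A.
Proof.
move=> trA t0 y; have [-> _ _] := triangular_image u y trA.
by rewrite sgrM (gtr0_sg t0) mulr1.
Qed.

Lemma triangular_w_oriented A : triangular A -> A \in unitmx ->
  0 < wvar (vecY R 2 *m A) -> w_oriented A.
Proof.
move=> trA uA w0; have [tT xX _] := triangular_unit 0 trA uA.
have img y := triangular_image 0 y trA.
split=> y; last first.
  move=> /lsubmx_eq0[ty xy]; have [_ _ /(_ ty xy 2)] := img y.
  rewrite /riemann /vecY /= mkpointE divr1 => ->.
  by rewrite sgrM (gtr0_sg w0) mulr1.
apply/eqP/eqP => /lsubmx_eq0[ty xy]; apply/lsubmx_eq0; have [tE xE _] := img y.
  have t0 : tvar y = 0.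
    by apply/eqP; rewrite -(mulIr_eq0 _ (mulIf tT)) -tE ty.
  by split=> //; apply/eqP; rewrite -(mulIr_eq0 _ (mulIf xX)) -xE // xy.
by rewrite tE xE // ty xy !mul0r.
Qed.

Lemma time_orientedM A B :
  time_oriented A -> time_oriented B -> time_oriented (A *m B).
Proof. by move=> oA oB y; rewrite mulmxA oB oA. Qed.

Lemma time_orientedV A B :
  time_oriented A -> B *m A = 1%:M -> time_oriented B.
Proof. by move=> oA BA y; rewrite -(oA (y *m B)) -mulmxA BA mulmx1. Qed.

Lemma w_orientedM A B : w_oriented A -> w_oriented B -> w_oriented (A *m B).
Proof.
move=> [zA oA] [zB oB]; split=> y; first by rewrite mulmxA zB zA.
by move=> y0; rewrite mulmxA oB ?oA //; apply/eqP; rewrite zA y0.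
Qed.

Lemma w_orientedV A B : w_oriented A -> B *m A = 1%:M -> w_oriented B.
Proof.
move=> [zA oA] BA.
have zB y : (lsubmx (y *m B) == 0) = (lsubmx y == 0).
  by rewrite -(zA (y *m B)) -mulmxA BA mulmx1.
by split=> // y y0; rewrite -(oA (y *m B)) -?mulmxA ?BA ?mulmx1 //; apply/eqP; rewrite zB y0.
Qed.

End Structure.

(** * Jacobians under composition, inversion and gluing *)

Section Differentials.
Variable R : realType.

Lemma rV_linear_differentiable n (W : normedModType R)
  (f : {linear 'rV[R]_n -> W}) x : differentiable f x.
Proof.
have -> : (f : _ -> _) = \sum_(k < n) (fun z : 'rV[R]_n => z 0 k *: f (delta_mx 0 k)).
  apply/funext => z; rewrite fct_sumE {1}(row_sum_delta z) linear_sum.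
  by apply: eq_bigr => k _; rewrite linearZ.
apply: differentiable_sum => k; apply: differentiableZl.
exact: differentiable_coord.
Qed.

Lemma rV_linear_continuous n (W : normedModType R)
  (f : {linear 'rV[R]_n -> W}) : continuous f.
Proof. by move=> x; apply/differentiable_continuous/rV_linear_differentiable. Qed.

(** The first-order expansion depends only on the germ; uniqueness of the differential does the
    rest. *)
Lemma near_eq_diff (V W : normedModType R) (f g : V -> W) x :
    (\near x, f x = g x) -> differentiable f x ->
  differentiable g x /\ 'd g x = 'd f x :> (V -> W).
Proof.
move=> fg df; have [dfc dfE] := (diff_locallyP _ _).1 df.
have gE : g \o shift x = cst (g x) + 'd f x +o_ 0 id.
  apply/eqaddoE; apply/eqaddoP => _/posnumP[e].
  have /eqaddoP/(_ e%:num (gt0 e)) fo := dfE.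
  have fg0 : \forall h \near 0, f (h + x) = g (h + x).
    by move: fg; rewrite (near_shift 0 x) subr0.
  near=> h; have fgh : f (h + x) = g (h + x) by near: h.
  have : `|(f \o shift x - (cst (f x) + 'd f x)) h| <= e%:num * `|h| by near: h.
  by rewrite !fctE /= fgh (nbhs_singleton fg).
have dgE : 'd g x = 'd f x :> (V -> W) by apply: diff_unique dfc gE.
split; last exact: dgE.
by apply/diff_locallyP; rewrite dgE; split.
Unshelve. all: by end_near. Qed.

Lemma mulmx_jacobian m n (f : 'rV[R]_m -> 'rV[R]_n) x v :
  v *m 'J f x = 'd f x v.
Proof. by rewrite /jacobian mul_rV_lin1. Qed.

Lemma mulmx_rV_inj m n (A B : 'M[R]_(m, n)) :
  (forall v : 'rV_m, v *m A = v *m B) -> A = B.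
Proof. by move=> AB; apply/row_matrixP => i; rewrite !rowE. Qed.

Lemma near_eq_jacobian m n (f g : 'rV[R]_m -> 'rV[R]_n) x :
  (\near x, f x = g x) -> differentiable f x -> 'J g x = 'J f x.
Proof.
move=> fg df; apply: mulmx_rV_inj => v.
have dE := congr1 (fun h => h v) (near_eq_diff fg df).2.
exact: etrans (mulmx_jacobian g x v) (etrans dE (esym (mulmx_jacobian f x v))).
Qed.

Lemma jacobian_comp m n p (f : 'rV[R]_m -> 'rV[R]_n) (g : 'rV[R]_n -> 'rV[R]_p) x :
  differentiable f x -> differentiable g (f x) ->
  'J (g \o f) x = 'J f x *m 'J g (f x).
Proof.
move=> df dg; apply: mulmx_rV_inj => v.
apply: (etrans (mulmx_jacobian _ x v)).
rewrite mulmxA diff_comp //; apply/esym.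
apply: (etrans (mulmx_jacobian _ _ _)).
by congr ('d g (f x) _); exact: mulmx_jacobian.
Qed.

Lemma jacobian_linear m n (f : {linear 'rV[R]_m -> 'rV[R]_n}) x v :
  v *m 'J f x = f v.
Proof. by rewrite mulmx_jacobian diff_lin //; exact: rV_linear_continuous. Qed.

Lemma jacobian_near_id n (f : 'rV[R]_n -> 'rV[R]_n) x :
  (\near x, f x = x) -> 'J f x = 1%:M.
Proof.
move=> fid; have idf : \forall y \near x, id y = f y.
  by near=> y; apply/esym; near: y.
have did : differentiable id x by exact: (rV_linear_differentiable idfun).
rewrite (near_eq_jacobian idf did); apply: mulmx_rV_inj => v.
by rewrite mulmx1; exact: (jacobian_linear idfun).
Unshelve. all: by end_near. Qed.

Lemma open_nbhs_near (T : topologicalType) (U : set T) (P : T -> Prop) x :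
  open U -> U x -> (forall y, U y -> P y) -> \forall y \near x, P y.
Proof.
move=> oU Ux UP; apply: filterS UP _; exact: open_nbhs_nbhs.
Qed.

(** Induction on generation: the chain rule reduces composition and inversion to the closure
    properties of [P], and gluing preserves germs. *)
Lemma generated_jacobian (P : 'M[R]_(2 + 3) -> Prop)
    (A : set (Defs.space R) -> (Defs.space R -> Defs.space R) -> Prop) :
  (forall M N, P M -> P N -> P (M *m N)) ->
  (forall M N, P M -> N *m M = 1%:M -> P N) ->
  (forall U Phi, A U Phi ->
     open U /\ forall z, U z -> differentiable Phi z /\ P ('J Phi z)) ->
  forall U Phi, generated A U Phi ->
     open U /\ forall z, U z -> differentiable Phi z /\ P ('J Phi z).
Proof.
move=> PM PV PA U Phi; elim=> {U Phi}.
- exact: PA.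
- move=> U V Phi Psi _ [oU hU] _ [oV hV] UV; split; first exact: oU.
  move=> z Uz; have [dPhi PPhi] := hU z Uz.
  have [dPsi PPsi] := hV (Phi z) (UV _ (imageP _ Uz)).
  split; first exact: differentiable_comp dPhi dPsi.
  have JE := jacobian_comp dPhi dPsi; rewrite /comp in JE *.
  by rewrite JE; apply: PM PPhi PPsi.
- move=> U Phi Psi _ [oU hU] [oV smPsi _ _] PsiK; split; first exact: oV.
  move=> _ [z Uz <-]; have [dPhi PPhi] := hU z Uz.
  have dPsi : differentiable Psi (Phi z) by exact: (smPsi [::]) (imageP _ Uz).
  split; first exact: dPsi.
  (* With row vectors the chain rule puts ['J Phi z] on the left, while [PV] needs it on the
     right. *)
  apply: PV PPhi _; apply: mulmx1C; apply: etrans (esym (jacobian_comp dPhi dPsi)) _.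
  by apply: jacobian_near_id; exact: open_nbhs_near oU Uz PsiK.
- move=> U Phi V F oU Vz _ hF PhiF; split; first exact: oU.
  move=> z Uz; have [oV /(_ z (Vz z Uz)) [dF PF]] := hF z Uz.
  have FPhi : \forall y \near z, F z y = Phi y.
    apply: (open_nbhs_near (openI oU oV)); first by split; [|exact: Vz].
    by move=> y [Uy Vy]; rewrite (PhiF z).
  have [dPhi _] := near_eq_diff FPhi dF.
  split; first exact: dPhi.
  have JE := near_eq_jacobian FPhi dF.
  by rewrite JE; exact: PF.
Qed.

End Differentials.

(** * Continuation along isotopies by connectedness *)

Section Isotopies.
Variable R : realType.

Lemma continuous_sum_ord (T : topologicalType) (W : normedModType R) n
  (f : 'I_n -> T -> W) :
  (forall k, continuous (f k)) -> continuous (fun s => \sum_k f k s).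
Proof.
move=> cf s.
rewrite (_ : (fun s => _) = \sum_k f k); last by rewrite fct_sumE.
elim/big_ind: _ => [|g h|k _]; [exact: cvg_cst|exact: cvgD|exact: cf].
Qed.

(* Extends an isotopy to a path parametrized by the whole real line. *)
Definition clamp01 (s : R) : R := Num.max 0 (Num.min 1 s).

Lemma clamp01_itv s : `[0, 1]%classic (clamp01 s).
Proof.
by rewrite /= in_itv /= /clamp01 le_max lexx /= ge_max ler01 /= ge_min lexx.
Qed.

Lemma clamp01_id s : `[0, 1]%classic s -> clamp01 s = s.
Proof.
by rewrite /= in_itv /= => /andP[s0 s1]; rewrite /clamp01 min_r // max_r.
Qed.

Lemma continuous_clamp01 : continuous clamp01.
Proof.
move=> s; apply: (@continuous_max R R (cst 0) (fun s => Num.min 1 s)).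
  exact: cvg_cst.
apply: (@continuous_min R R (cst 1) id); first exact: cvg_cst.
exact: cvg_id.
Qed.

Lemma continuous_clamp01_path (U : set (space R)) (F : R * space R -> space R) z :
  U z -> {within `[0, 1] `*` U, continuous F} ->
  continuous (fun s => F (clamp01 s, z)).
Proof.
move=> Uz /subspace_continuousP cF s.
have AU s' : (`[0, 1] `*` U) (clamp01 s', z) by split => //; exact: clamp01_itv.
have pair_cvg : (clamp01 s', z) @[s' --> s] --> (clamp01 s, z).
  exact: (cvg_pair (@continuous_clamp01 s) (cvg_cst z)).
apply: (@cvg_comp _ _ _ (fun s => (clamp01 s, z)) F); last exact: cF (AU s).
(* The clamped point never leaves the domain, so a neighbourhood relative to the domain pulls back
   to an ordinary one. *)
move=> B wB; have : nbhs s [set s' | (`[0, 1] `*` U) (clamp01 s', z) ->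
    B (clamp01 s', z)] := pair_cvg _ wB.
by apply: filterS => s' /(_ (AU s')).
Qed.

Lemma open_positive (f : R -> R) : continuous f -> open [set s | 0 < f s].
Proof. by move=> /continuousP cf; apply: (cf [set x | 0 < x]); exact: open_gt. Qed.

Lemma open_nonzero (f : R -> R) : continuous f -> open [set s | f s != 0].
Proof. by move=> /continuousP cf; apply: (cf [set x | x != 0]); exact: open_neq. Qed.

Lemma closed_nonneg (f : R -> R) : continuous f -> closed [set s | 0 <= f s].
Proof. by move=> /continuous_closedP cf; apply: (cf [set x | 0 <= x]); exact: closed_ge. Qed.

Lemma closed_zero (f : R -> R) : continuous f -> closed [set s | f s = 0].
Proof. by move=> /continuous_closedP cf; apply: (cf [set x | x = 0]); exact: closed_eq. Qed.

Lemma clopen_real_line (N : set R) : open N -> closed N -> N !=set0 -> N = setT.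
Proof.
move=> oN cN N0; have /connected_intervalP cT : is_interval [set: R] by [].
by apply: cT => //; [exists N => //; rewrite setTI|exists N => //; rewrite setTI].
Qed.

Section Path.
Variables (u : R) (u' : R -> R) (A : R -> 'M[R]_(2 + 3)).
Hypothesis u'_cont : continuous u'.
Hypothesis A_cont : forall y, continuous (fun s => y *m A s : space R).
Hypothesis A_unit : forall s, A s \in unitmx.
Hypothesis A_sym : forall s, symmetry_at u (u' s) (A s).
Hypothesis A0 : A 0 = 1%:M.

(** The good parameters: an open and closed set containing 0, hence the whole line. *)
Let N : set R :=
  [set s | noncharacteristic u (u' s) (A s)] `&`
  ([set s | 0 < tvar (vecT u *m A s)] `&` [set s | 0 < wvar (vecY R 2 *m A s)]).

Let functional_cont (f : {linear space R -> R^o}) y :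
  continuous (fun s => f (y *m A s) : R).
Proof.
move=> s; apply: (@continuous_comp _ _ _ (fun s => y *m A s) f).
  exact: A_cont.
exact: rV_linear_continuous.
Qed.

Let bilinear_cont (f g : R -> space R -> R) y z :
  (forall y, continuous (fun s => f s (y *m A s))) ->
  (forall y, continuous (fun s => g s (y *m A s))) ->
  continuous (fun s => f s (y *m A s) * g s (z *m A s) -
                       g s (y *m A s) * f s (z *m A s)).
Proof.
move=> cf cg s.
by apply: cvgB; apply: cvgM; first [exact: cf|exact: cg].
Qed.

Let contact_cont i y : continuous (fun s => contact (u' s) i (y *m A s)).
Proof.
have xc : continuous (fun s => xvar (y *m A s)) := @functional_cont (@xvar R) y.
have tc : continuous (fun s => tvar (y *m A s)) := @functional_cont (@tvar R) y.
move=> s; apply: cvgB; first exact: xc.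
apply: cvgM; last exact: tc.
by apply: cvgD; [exact: u'_cont|exact: cvg_cst].
Qed.

Let openN : open N.
Proof.
apply: openI; last first.
  by apply: openI; apply: open_positive; exact: functional_cont.
pose W i := [set s | wedge (u' s) i (vecY R i *m A s) (vecX R *m A s) != 0].
have oW i : open (W i).
  apply: open_nonzero.
  exact: (bilinear_cont (f := fun=> riemann i) (g := fun s => contact (u' s) i)).
have -> : [set s | noncharacteristic u (u' s) (A s)] =
  [set s | area (vecT u *m A s) (vecX R *m A s) != 0] `&` (W 0 `&` (W 1 `&` W 2)).
  apply/seteqP; split=> s /=.
    by move=> [a w]; split; [|split; [|split]]; rewrite ?/W /=; first [exact: a|exact: w].
  by move=> [a [w0 [w1 w2]]]; split; [exact: a|apply: ord3_ind].
apply: openI; last by apply: openI; [|apply: openI].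
apply: open_nonzero.
by apply: (bilinear_cont (f := fun=> @tvar R) (g := fun=> @xvar R));
  exact: functional_cont.
Qed.

(** For the symmetries [A s] the strict conditions amount to closed ones: [triangular] and
    nonnegativity of two diagonal entries, which invertibility keeps away from 0. *)
Let closedN : closed N.
Proof.
have -> : N =
  [set s | tvar (vecX R *m A s) = 0] `&`
  (\bigcap_k [set s | tvar (vecY R k *m A s) = 0]) `&`
  (\bigcap_k [set s | xvar (vecY R k *m A s) = 0]) `&`
  (\bigcap_(ik in [set ik : 'I_3 * 'I_3 | ik.1 != ik.2])
    [set s | riemann ik.1 (vecY R ik.2 *m A s) = 0]) `&`
  [set s | 0 <= tvar (vecT u *m A s)] `&` [set s | 0 <= wvar (vecY R 2 *m A s)].
  apply/seteqP; split=> s.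
    move=> [/= n [t0 w0]]; have [tX tY xY rY] := symmetry_at_triangular (@A_sym s) n.
    split; last exact: ltW.
    split; last exact: ltW.
    split; last by move=> [i k] /= ik; exact: rY.
    by split; [split; [|move=> k _; exact: tY]|move=> k _; exact: xY].
  move=> [[[[[/= tX tY] xY] rY] t0] w0].
  have tri : triangular (A s).
    split=> [|k|k|i k ik]; [exact: tX|exact: tY|exact: xY|exact: (rY (i, k))].
  have [tT _ rN0] := triangular_unit u tri (A_unit s).
  split; first exact: triangular_noncharacteristic.
  split; rewrite /= lt_neqAle eq_sym; apply/andP; split=> //.
  exact: (rN0 2).
apply: closedI; last by apply: closed_nonneg; exact: functional_cont.
apply: closedI; last by apply: closed_nonneg; exact: functional_cont.
apply: closedI; last first.
  by apply: closed_bigI => k _; apply: closed_zero; exact: functional_cont.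
apply: closedI; last first.
  by apply: closed_bigI => k _; apply: closed_zero; exact: functional_cont.
apply: closedI; last first.
  by apply: closed_bigI => k _; apply: closed_zero; exact: functional_cont.
by apply: closed_zero; exact: functional_cont.
Qed.

Lemma path_oriented s : time_oriented (A s) /\ w_oriented (A s).
Proof.
have NT : N = setT.
  apply: clopen_real_line => //; exists 0; rewrite /N /= A0.
  split; last by rewrite !mulmx1 /vecY /= !mkpointE ltr01.
  apply: triangular_noncharacteristic; last exact: unitmx1.
  split=> [|k|k|i k ik]; rewrite mulmx1 ?mkpointE ?tvar_vecY ?xvar_vecY //.
  by rewrite riemann_vecY (negbTE ik).
have [/= n [t0 w0]] : N s by rewrite NT.
have tri := symmetry_at_triangular (@A_sym s) n.
by split; [exact: triangular_time_oriented tri t0|exact: triangular_w_oriented].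
Qed.

End Path.

(** This is [path_oriented] for the Jacobians of the isotopy at a fixed point [z]. *)
Lemma isotopic_jacobian U (Phi : space R -> space R) :
  isotopic_to_identity U Phi ->
  open U /\ forall z, U z ->
    differentiable Phi z /\ time_oriented ('J Phi z) /\ w_oriented ('J Phi z).
Proof.
move=> [H [symH cH H0 H1]].
have sym s : point_symmetry U (H (clamp01 s)) by exact/symH/clamp01_itv.
have [oU _ _ _] := sym 0; split; first exact: oU.
move=> z Uz.
have dH s : differentiable (H (clamp01 s)) z.
  by have [_ smH _ _] := sym s; exact: (smH [::]).
have c0 : clamp01 0 = 0 by apply: clamp01_id; rewrite /= in_itv /= lexx ler01.
have c1 : clamp01 1 = 1 by apply: clamp01_id; rewrite /= in_itv /= lexx ler01.
have Phi1 : \forall y \near z, H (clamp01 1) y = Phi y.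
  by rewrite c1; apply: open_nbhs_near oU Uz H1.
have [dPhi _] := near_eq_diff Phi1 (dH 1); split; first exact: dPhi.
have -> : 'J Phi z = 'J (H (clamp01 1)) z by exact: near_eq_jacobian Phi1 (dH 1).
apply: (@path_oriented (uvar z) (fun s => uvar (H (clamp01 s) z))
  (fun s => 'J (H (clamp01 s)) z)).
- move=> s; have cHz := continuous_clamp01_path Uz (cH [::]).
  apply: (@continuous_comp _ _ _ (fun s => H (clamp01 s) z) (@uvar R)).
    exact: cHz.
  exact: (@rV_linear_continuous _ _ _ (@uvar R)).
- move=> y.
  have hk k : continuous (fun s => iterated_partial [:: k] (H (clamp01 s)) z).
    exact: continuous_clamp01_path Uz (cH [:: k]).
  (* The rows of the Jacobian are the first partial derivatives, whose continuity in the parameter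
     is part of an isotopy. *)
  have -> : (fun s => y *m 'J (H (clamp01 s)) z) =
    fun s => \sum_k y 0 k *: iterated_partial [:: k] (H (clamp01 s)) z.
    apply/funext => s; rewrite mulmx_sum_row; apply: eq_bigr => k _.
    congr (_ *: _); rewrite rowE; apply/esym.
    exact: deriveEjacobian (dH s).
  apply: continuous_sum_ord => k s.
  exact: cvgZ (cvg_cst (y 0 k)) (@hk k s).
- move=> s; have [_ _ detN0 _] := sym s.
  by rewrite unitmxE unitfE; exact: detN0.
- by move=> s; exact: point_symmetry_at.
- by apply: jacobian_near_id; rewrite c0; apply: open_nbhs_near oU Uz H0.
Qed.

End Isotopies.

(** * The two reflections and the conditions separating them *)

Section Reflections.
Variable R : realType.
Implicit Types (y z : space R) (c e : R).

Definition scaling c e z : space R :=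
  mkpoint (c * tvar z) (c * xvar z) (uvar z) (vvar z) (e * wvar z).

Fact scaling_is_linear c e : linear (scaling c e).
Proof.
move=> a y z; rewrite /scaling; apply: space_ext;
  rewrite !linearP /= !mkpointE /GRing.scale /=; ring.
Qed.
HB.instance Definition _ c e :=
  GRing.isLinear.Build R (space R) (space R) _ (scaling c e) (scaling_is_linear c e).

Lemma reflection_tx_scaling : @reflection_tx R = scaling (-1) 1.
Proof. by apply/funext => z; rewrite /scaling !mulN1r mul1r. Qed.

Lemma reflection_w_scaling : @reflection_w R = scaling 1 (-1).
Proof. by apply/funext => z; rewrite /scaling mulN1r !mul1r. Qed.

(** Iterated partial derivatives of a linear map are the map itself or constants. *)
Lemma smooth_linear U (f : {linear space R -> space R}) : smooth_on U f.
Proof.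
move=> s z _; suff [->|[k ->]] : iterated_partial s f = f \/
    exists k, iterated_partial s f = cst k.
- exact: rV_linear_differentiable.
- exact: differentiable_cst.
elim: s => [|k s [/= ->|[b /= ->]]]; [by left|right|right].
- exists (f (delta_mx 0 k)); apply/funext => y.
  by rewrite deriveEjacobian ?jacobian_linear //; exact: rV_linear_differentiable.
- by exists 0; apply/funext => y; exact: derive_cst.
Qed.

Lemma scaling_jacobian c e z y : y *m 'J (scaling c e) z = scaling c e y.
Proof. exact: jacobian_linear. Qed.

(** The base derivative is the scalar matrix [c], so prolongation divides all derivatives by [c] and
    multiplies those of w by [e]; each equation is rescaled by a nonzero factor. *)
Lemma scaling_point_symmetry c e : c * c = 1 -> e * e = 1 ->
  point_symmetry setT (scaling c e).
Proof.
move=> cc ee.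
have c0 : c != 0 by apply/eqP => c0; move/eqP: cc; rewrite c0 mul0r eq_sym oner_eq0.
have e0 : e != 0 by apply/eqP => e0; move/eqP: ee; rewrite e0 mul0r eq_sym oner_eq0.
split; [exact: openT|exact: smooth_linear| |].
- move=> z _; have JJ : 'J (scaling c e) z *m 'J (scaling c e) z = 1%:M.
    apply: mulmx_rV_inj => y; rewrite mulmxA mulmx1.
    rewrite (scaling_jacobian c e z y) (scaling_jacobian c e z).
    by apply: space_ext; rewrite /scaling !mkpointE // mulrA ?cc ?ee mul1r.
  by have [uJ _] := mulmx1_unit JJ; rewrite -unitfE -unitmxE.
move=> z p _ _; set M := row_mx 1%:M p.
have rowM k : row k (total_derivative (scaling c e) z p) = scaling c e (row k M).
  by rewrite row_mul; exact: scaling_jacobian.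
have [tM xM] : (forall k, tvar (row k M) = (k == 0)%:R) /\
    (forall k, xvar (row k M) = (k == 1)%:R).
  by split=> k; rewrite row_row_mx /tvar /xvar row_mxKl !mxE.
have depM k : [/\ uvar (row k M) = p k 0, vvar (row k M) = p k 1 &
    wvar (row k M) = p k 2].
  by rewrite row_row_mx /uvar /vvar /wvar row_mxKr !mxE.
have baseE : base_derivative (scaling c e) z p = c%:M.
  apply/matrixP => k j; have <- : lsubmx (row k (total_derivative (scaling c e) z p)) 0 j
    = base_derivative (scaling c e) z p k j by rewrite !mxE.
  rewrite rowM /scaling row_mxKl tM xM; move: j k.
  by apply: ord2_ind; apply: ord2_ind; rewrite !mxE /= ?mulr1 ?mulr0.
have fibreE k : [/\ fibre_derivative (scaling c e) z p k 0 = p k 0,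
    fibre_derivative (scaling c e) z p k 1 = p k 1 &
    fibre_derivative (scaling c e) z p k 2 = e * p k 2].
  have fE j : fibre_derivative (scaling c e) z p k j =
      rsubmx (row k (total_derivative (scaling c e) z p)) 0 j by rewrite !mxE.
  have [uM vM wM] := depM k.
  by rewrite !fE rowM /scaling row_mxKr uM vM wM !mxE.
have prolongE k j : prolong (scaling c e) z p k j =
    c^-1 * fibre_derivative (scaling c e) z p k j.
  by rewrite /prolong baseE invmx_scalar mul_scalar_mx mxE.
have [f00 f01 f02] := fibreE 0; have [f10 f11 f12] := fibreE 1.
rewrite /drift_flux_system !prolongE f00 f01 f02 f10 f11 f12 {1}/scaling mkpointE.
set u := uvar z.
have -> : c^-1 * p 0 0 + u * (c^-1 * p 1 0) + c^-1 * p 1 1 =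
  c^-1 * (p 0 0 + u * p 1 0 + p 1 1) by ring.
have -> : c^-1 * p 0 1 + u * (c^-1 * p 1 1) + c^-1 * p 1 0 =
  c^-1 * (p 0 1 + u * p 1 1 + p 1 0) by ring.
have -> : c^-1 * (e * p 0 2) + u * (c^-1 * (e * p 1 2)) =
  (c^-1 * e) * (p 0 2 + u * p 1 2) by ring.
split=> [[-> -> ->]|[/eqP + /eqP + /eqP]]; first by rewrite !mulr0.
rewrite !mulf_eq0 invr_eq0 (negbTE c0) (negbTE e0) /=.
by move=> /eqP -> /eqP -> /eqP ->.
Qed.

Lemma not_generated_by_jacobian (P : 'M[R]_(2 + 3) -> Prop)
    (A : set (space R) -> (space R -> space R) -> Prop) Phi V :
  (forall M N, P M -> P N -> P (M *m N)) ->
  (forall M N, P M -> N *m M = 1%:M -> P N) ->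
  (forall U Psi, A U Psi ->
     open U /\ forall z, U z -> differentiable Psi z /\ P ('J Psi z)) ->
  V !=set0 -> (forall z, ~ P ('J Phi z)) -> ~ generated A V Phi.
Proof.
move=> PM PV PA [z Vz] PN gPhi.
have [_ /(_ z Vz) [_ PJ]] := generated_jacobian PM PV PA gPhi.
exact: PN PJ.
Qed.

Lemma scaling_time_oriented c e z :
  time_oriented ('J (scaling c e) z) <-> 0 < c.
Proof.
split=> [/(_ (vecT 0))|c0 y].
  rewrite (scaling_jacobian c e z) /scaling !mkpointE mulr1 sgr1 => /eqP.
  by rewrite sgr_cp0.
by rewrite (scaling_jacobian c e z) /scaling mkpointE sgrM (gtr0_sg c0) mul1r.
Qed.

Lemma scaling_w_oriented c e z : c != 0 ->
  w_oriented ('J (scaling c e) z) <-> 0 < e.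
Proof.
move=> c0; split=> [[_ /(_ (vecY R 2))]|e0].
  rewrite (scaling_jacobian c e z) /scaling !mkpointE mulr1 sgr1 => h.
  have /h/eqP : lsubmx (vecY R 2) = 0.
    by apply/lsubmx_eq0; rewrite tvar_vecY xvar_vecY.
  by rewrite sgr_cp0.
split=> y; rewrite (scaling_jacobian c e z) /scaling.
  apply/eqP/eqP => /lsubmx_eq0[+ +]; rewrite ?mkpointE => ty xy; apply/lsubmx_eq0.
    by split; apply/eqP; rewrite -(mulrI_eq0 _ (mulfI c0)) ?ty ?xy.
  by rewrite !mkpointE ty xy mulr0.
by move=> _; rewrite mkpointE sgrM (gtr0_sg e0) mul1r.
Qed.

(** The hypothesis on [A] covers isotopies alone and isotopies with the other reflection, so the
    lemma serves both discreteness and independence. *)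
Lemma not_generated_reflection_tx A V :
  (forall U (Psi : space R -> space R), A U Psi ->
    isotopic_to_identity U Psi \/
    point_symmetry U Psi /\ Psi = @reflection_w R) ->
  V !=set0 -> ~ generated A V (@reflection_tx R).
Proof.
move=> hA V0; apply: (not_generated_by_jacobian (P := @time_oriented R)) V0 _.
- exact: time_orientedM.
- exact: time_orientedV.
- move=> U Psi /hA[/isotopic_jacobian[oU h]|[[oU smPsi _ _] ->]]; split=> // z Uz.
    by have [dPsi [tP _]] := h z Uz.
  rewrite reflection_w_scaling; split; first exact: rV_linear_differentiable.
  by apply/scaling_time_oriented; exact: ltr01.
- by move=> z; rewrite reflection_tx_scaling => /scaling_time_oriented; lra.
Qed.

(** The separating condition is now [w_oriented]: [reflection_tx] satisfies it, as it preserves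
    vertical vectors and fixes their w-component. *)
Lemma not_generated_reflection_w A V :
  (forall U (Psi : space R -> space R), A U Psi ->
    isotopic_to_identity U Psi \/
    point_symmetry U Psi /\ Psi = @reflection_tx R) ->
  V !=set0 -> ~ generated A V (@reflection_w R).
Proof.
move=> hA V0; apply: (not_generated_by_jacobian (P := @w_oriented R)) V0 _.
- exact: w_orientedM.
- exact: w_orientedV.
- move=> U Psi /hA[/isotopic_jacobian[oU h]|[[oU smPsi _ _] ->]]; split=> // z Uz.
    by have [dPsi [_ wP]] := h z Uz.
  rewrite reflection_tx_scaling; split; first exact: rV_linear_differentiable.
  by apply/scaling_w_oriented; [rewrite oppr_eq0 oner_eq0|exact: ltr01].
- move=> z; rewrite reflection_w_scaling.
  by move=> /(scaling_w_oriented _ _ (oner_neq0 R)); lra.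
Qed.

End Reflections.

Theorem corollary10 (R : realType) :
  discrete_symmetry setT (@reflection_tx R) /\
  discrete_symmetry setT (@reflection_w R) /\
  independent_symmetries (@reflection_tx R) (@reflection_w R).
Proof.
have sqN1 : (-1) * (-1) = 1 :> R by rewrite mulrNN mulr1.
split; [|split].
- split=> [|V _ V0 _].
    by rewrite reflection_tx_scaling; apply: scaling_point_symmetry; rewrite ?mulr1.
  by apply: not_generated_reflection_tx V0 => U Psi; left.
- split=> [|V _ V0 _].
    by rewrite reflection_w_scaling; apply: scaling_point_symmetry; rewrite ?mulr1.
  by apply: not_generated_reflection_w V0 => U Psi; left.
- move=> V _ V0; split.
    exact: not_generated_reflection_tx V0.
  exact: not_generated_reflection_w V0.
Qed.
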